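(* Let $S_{\lambda}\in\mathcal{B}(\ell^2(V))$ be a weighted shift on $\ell^2(V)$ with weights $(\lambda_v)_{v\in V^0}$. Then $S_{\lambda}$ is quasi-$\ast$-paranormal if and only if $$\|S_{\lambda}^3e_v\|^2 -2k \|S_{\lambda}e_v\|^4+k^2 \|S_{\lambda}e_v\|^2 \geq 0$$ for all $k>0$ and all $v\in V$.
   Context: $G=(V,E)$ is a directed graph in which every vertex $v$ has at most one parent: $(u,v)\in E\subset V\times V$ means $u=par(v)$ is the parent of $v$, and $v$ is a child of $u$. A vertex with no parent is a root, and $V^0$ is $V$ minus the set of roots. $\ell^2(V)$ is the Hilbert space of square summable complex functions on $V$ with orthonormal basis $\{e_u\}_{u\in V}$, $e_u(v)=1$ if $v=u$ and $0$ otherwise. For complex weights $(\lambda_v)_{v\in V^0}$, the weighted shift $S_\lambda$ is given by $(S_\lambda f)(v)=\lambda_v f(par(v))$ if $v$ is not a root and $(S_\lambda f)(v)=0$ if $v$ is a root. $\mathcal{B}(\mathcal{H})$ denotes the bounded linear operators on a Hilbert space $\mathcal{H}$. An operator $T\in\mathcal{B}(\mathcal{H})$ is quasi-$\ast$-paranormal if $\|T^*Tx\|^2\le\|T^3x\|\,\|Tx\|$ for all $x\in\mathcal{H}$. *)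

(* Defs.v *)
From HB Require Import structures.
From mathcomp Require Import all_boot all_order all_algebra.
From mathcomp Require Import all_classical all_reals all_analysis.
From mathcomp Require Import complex ring.

Set Implicit Arguments.
Unset Strict Implicit.
Unset Printing Implicit Defensive.

Import Order.TTheory GRing.Theory Num.Theory Normc.

Local Open Scope classical_set_scope.
Local Open Scope ring_scope.
Local Open Scope complex_scope.

(* (u, v) is an edge when u is a parent of v. *)
Record parent_graph (V : Type) := ParentGraph {
  edges : set (V * V);
  edges_parent_uniq : forall u u' v, edges (u, v) -> edges (u', v) -> u = u' }.

Section Parent.
Variables (V : Type) (G : parent_graph V).

Definition roots : set V := [set v | forall u, ~ edges G (u, v)].

Definition V0 : set V := ~` roots.

Lemma V0_has_parent (v : V0) : exists u, edges G (u, val v).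
Proof.
by have := set_valP v; rewrite /V0 /roots /= => /existsNP [u /contrapT]; exists u.
Qed.

Definition par (v : V0) : V := sval (cid (V0_has_parent v)).

Lemma parP (v : V0) : edges G (par v, val v).
Proof. by rewrite /par; case: cid. Qed.

Lemma par_uniq (v : V0) u : edges G (u, val v) -> par v = u.
Proof. by move=> Guv; exact: edges_parent_uniq (parP v) Guv. Qed.

End Parent.

(* [normc] is the R-valued modulus on R[i].  Scalars are taken in R[i]^o because
   plain R[i] is canonically a module over R, not over R[i]. *)
Section SquareSummable.
Variables (R : realType) (V : choiceType).
Implicit Types f g : V -> R[i]^o.

Definition sqsum f : \bar R := \esum_(v in [set: V]) (normc (f v) ^+ 2)%:E.

Definition square_summable : {pred (V -> R[i]^o)} :=
  fun f => (sqsum f < +oo)%E.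

Lemma normc_sqrD (a b : R[i]) :
  normc (a + b) ^+ 2 <= 2 * normc a ^+ 2 + 2 * normc b ^+ 2.
Proof.
case: a b => [x y] [z t] /=.
rewrite !sqr_sqrtr ?addr_ge0 ?sqr_ge0// -subr_ge0.
rewrite [leRHS](_ : _ = (x - z) ^+ 2 + (y - t) ^+ 2); last by ring.
by rewrite addr_ge0 ?sqr_ge0.
Qed.

Lemma sqsumZ_lty (c : R) (h : V -> R) : 0 <= c -> (forall v, 0 <= h v) ->
  (\esum_(v in [set: V]) (h v)%:E < +oo)%E ->
  (\esum_(v in [set: V]) (c * h v)%:E < +oo)%E.
Proof.
move=> c0 h0 hoo.
have := @lte_mul_pinfty R c%:E _ _ _ hoo; rewrite lee_fin => /(_ c0 isT).
apply: le_lt_trans; apply: ge_ereal_sup => _ [A [finA AS] <-].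
under eq_fsbigr do rewrite EFinM.
rewrite -ge0_mule_fsumr; last by move=> v; rewrite lee_fin.
apply: lee_pmul => //; first by apply: fsume_ge0 => v _; rewrite lee_fin.
by apply: ereal_sup_ubound; exists A.
Qed.

Lemma square_summable_submod : submod_closed square_summable.
Proof.
split=> [|a f g].
  rewrite unfold_in /sqsum esum1// => v _.
  by rewrite [X in normc X](_ : _ = 0%C)// normc0 expr0n.
rewrite !unfold_in /sqsum => foo goo.
apply: (@le_lt_trans _ _ (\esum_(v in [set: V])
   ((2 * normc a ^+ 2) * normc (f v) ^+ 2)%:E +
    \esum_(v in [set: V]) (2 * normc (g v) ^+ 2)%:E)%E).
  rewrite -esumD; first last.
  - by move=> v _; rewrite lee_fin !(sqr_ge0, mulr_ge0).
  - by move=> v _; rewrite lee_fin !(sqr_ge0, mulr_ge0).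
  apply: le_esum => v _; rewrite -EFinD lee_fin.
  apply: le_trans (normc_sqrD _ _) _.
  by rewrite lerD2r normcM exprMn mulrA.
by apply: lte_add_pinfty; apply: sqsumZ_lty => // *;
   rewrite ?(sqr_ge0, mulr_ge0).
Qed.

HB.instance Definition _ := GRing.isSubmodClosed.Build _ _ square_summable
  square_summable_submod.

Lemma square_summable_delta (u : V) :
  (fun v => (v == u)%:R : R[i]^o) \in square_summable.
Proof.
rewrite unfold_in /sqsum (esumID [set u]); last first.
  by move=> v _; rewrite lee_fin sqr_ge0.
rewrite setTI esum_set1 ?lee_fin ?sqr_ge0// esum1 ?adde0 ?ltry// => v [_ /= vu].
by rewrite (introF eqP vu) normc0 expr0n.
Qed.

End SquareSummable.

Record l2 (R : realType) (V : choiceType) := L2 {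
  l2fun :> V -> R[i]^o;
  l2P : l2fun \in @square_summable R V }.

HB.instance Definition _ R V := [isSub for @l2fun R V].
HB.instance Definition _ R V := [Choice of l2 R V by <:].
HB.instance Definition _ R V := [SubChoice_isSubLmodule of l2 R V by <:].

Section Hilbert.
Variables (R : realType) (V : choiceType).
Implicit Types (x y : l2 R V) (v : V).

Definition e v : l2 R V := L2 (square_summable_delta R v).

(* ||x|| = (sum_v |x v|^2)^(1/2), the norm induced by [dot] below. *)
Definition l2norm x : R := Num.sqrt (fine (sqsum x)).

(* Unordered sum of an absolutely summable real family, as the difference of
   the sums of its positive and negative parts; [esum] alone is meaningful only
   for nonnegative families. *)
Definition rsum (a : V -> R) : R :=
  fine (\esum_(v in [set: V]) (EFin \o a)^\+ v
        - \esum_(v in [set: V]) (EFin \o a)^\- v)%E.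

(* The inner product, sum_v x v * conj (y v), linear in the first argument. *)
Definition dot x y : R[i] :=
  rsum (fun v => complex.Re (x v * conjc (y v)))
  +i* rsum (fun v => complex.Im (x v * conjc (y v))).

End Hilbert.

Arguments e {R V} v.

Record bounded_operator (R : realType) (V : choiceType) := BoundedOperator {
  op :> {linear l2 R V -> l2 R V};
  op_bounded : exists M : R, forall x, l2norm (op x) <= M * l2norm x }.

Section Operators.
Variables (R : realType) (V : choiceType).
Implicit Type T : bounded_operator R V.

Definition is_adjoint T (Ts : l2 R V -> l2 R V) :=
  forall x y, dot (T x) y = dot x (Ts y).

(* T^*.  By the Riesz representation theorem a bounded T has exactly one
   adjoint, so the default value of [xget] is never used. *)
Definition adjoint T : l2 R V -> l2 R V :=
  xget (fun=> 0) [set Ts | is_adjoint T Ts].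

Definition quasi_star_paranormal T := forall x,
  l2norm (adjoint T (T x)) ^+ 2 <= l2norm (iter 3 T x) * l2norm (T x).

(* T is the operator S_lambda. *)
Definition is_weighted_shift (G : parent_graph V) (lambda : V0 G -> R[i]) T :=
  forall f : l2 R V,
    (forall v : V0 G, T f (val v) = lambda v * f (par v)) /\
    (forall v, roots G v -> T f v = 0).

End Operators.

(* Main.v *)
Require Import Defs.
From HB Require Import structures.
From mathcomp Require Import all_boot all_order all_algebra.
From mathcomp Require Import all_classical all_reals all_analysis.
From mathcomp Require Import complex.
From mathcomp Require Import ring lra.

(* A weighted shift has the form S x v = w v * x (p v), so the vectors S (e u)
   have pairwise disjoint supports, and likewise for the vectors S^3 (e u).
   Hence ||S x||^2 = sum_u |x u|^2 ||S (e u)||^2, the same holds for S^3, and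
   S^* S is the diagonal operator with entries ||S (e u)||^2.  With
   A = ||S^3 x||^2, B = ||S x||^2 and X = ||S^* S x||^2, the inequality
   X^2 <= A B holds iff 2 k X <= A + k^2 B for all k > 0; the latter is linear
   in the weights |x u|^2, so it is enough to check it on basis vectors. *)

Set Implicit Arguments.
Unset Strict Implicit.
Unset Printing Implicit Defensive.

Import Order.TTheory GRing.Theory Num.Theory Normc.
Local Open Scope ring_scope.

(** * Nonnegative extended sums, and a discriminant criterion *)

(** Both sides are sums over pairs, matched by the swap of coordinates. *)
Lemma esum_exchange (R : realType) (T U : choiceType) (a : T -> U -> \bar R) :
  (forall t u, 0 <= a t u)%E ->
  (\esum_(t in [set: T]) \esum_(u in [set: U]) a t u =
   \esum_(u in [set: U]) \esum_(t in [set: T]) a t u)%E.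
Proof.
move=> a0; rewrite !(@esum_esum _ _ _ _ (fun=> setT))//.
apply: (@reindex_esum _ _ _ _ _ (fun z => (z.2, z.1))); split=> //.
- by move=> [? ?] [? ?] _ _ [-> ->].
- by move=> [t u] _; exists (u, t).
Qed.

Lemma esumZ (R : realType) (T : choiceType) (c : R) (a : T -> \bar R) :
  0 <= c -> (forall t, 0 <= a t)%E ->
  (\esum_(t in [set: T]) (c%:E * a t) = c%:E * \esum_(t in [set: T]) a t)%E.
Proof.
(* Scaling a supremum requires a nonempty set; the empty partial sum, 0, is a member. *)
move=> c0 a0; rewrite /esum -ereal_supZl//; last first.
  apply/set0P; exists 0%E, set0; first exact: fsets_set0.
  by rewrite fsbig_set0.
rewrite image_comp; congr ereal_sup; apply: eq_imagel => A [finA _] /=.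
by rewrite ge0_mule_fsumr.
Qed.

(** The quadratic [A - 2 k X + k ^+ 2 B] is evaluated at its minimiser [k = X / B] when [B] is
    nonzero. *)
Lemma sq_le_mul_of_quadratic (R : realType) (X A B : R) :
  0 <= X -> 0 <= A -> 0 <= B ->
  (forall k, 0 < k -> 2 * k * X <= A + k ^+ 2 * B) -> X ^+ 2 <= A * B.
Proof.
move=> X0 A0 B0 h.
have [->|Xn0] := eqVneq X 0; first by rewrite expr0n/= mulr_ge0.
have Xp : 0 < X by rewrite lt_neqAle eq_sym Xn0.
have [B0'|Bn0] := eqVneq B 0.
  (* With [B = 0], this [k] would give [2 (A + 1) <= A], contradicting [0 <= A]. *)
  have k0 : 0 < (A + 1) / X by rewrite divr_gt0// ltr_wpDl.
  have := h _ k0; rewrite B0' mulr0 addr0 -mulrA divfK//; lra.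
have Bp : 0 < B by rewrite lt_neqAle eq_sym Bn0.
have := h (X / B) (divr_gt0 Xp Bp).
have -> : 2 * (X / B) * X = 2 * (X ^+ 2 / B) by field.
have -> : (X / B) ^+ 2 * B = X ^+ 2 / B by field.
move=> h'; rewrite -ler_pdivrMr//; lra.
Qed.

(** * Sums of real families *)

(** Since [fine] sends [+oo] to 0, the value is faithful only under [nsummable]. *)
Definition nsum (R : realType) (T : choiceType) (a : T -> R) : R :=
  fine (\esum_(t in [set: T]) (a t)%:E).

Definition nsummable (R : realType) (T : choiceType) (a : T -> R) :=
  (forall t, 0 <= a t) /\ (\esum_(t in [set: T]) (a t)%:E < +oo)%E.

Lemma nsummable_esum {R : realType} {T : choiceType} {a : T -> R} :
  nsummable a -> (\esum_(t in [set: T]) (a t)%:E = (nsum a)%:E)%E.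
Proof.
move=> [a0 aoo]; rewrite fineK// ge0_fin_numE//.
by apply: esum_ge0 => t _; rewrite lee_fin.
Qed.

Lemma nsum_ge0 (R : realType) (T : choiceType) (a : T -> R) :
  (forall t, 0 <= a t) -> 0 <= nsum a.
Proof. by move=> a0; apply/fine_ge0/esum_ge0 => t _; rewrite lee_fin. Qed.

Lemma nsummable_le (R : realType) (T : choiceType) (a b : T -> R) :
  (forall t, 0 <= a t <= b t) -> nsummable b -> nsummable a.
Proof.
move=> ab [b0 boo]; split=> [t|]; first by have /andP[] := ab t.
apply: le_lt_trans boo; apply: le_esum => t _.
by rewrite lee_fin; have /andP[] := ab t.
Qed.

Lemma nsum_le (R : realType) (T : choiceType) (a b : T -> R) :
  (forall t, 0 <= a t <= b t) -> nsummable b -> nsum a <= nsum b.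
Proof.
move=> ab bs; have as_ := nsummable_le ab bs.
rewrite -lee_fin -!nsummable_esum//; apply: le_esum => t _.
by rewrite lee_fin; have /andP[] := ab t.
Qed.

Lemma esum_EFinD (R : realType) (T : choiceType) (a b : T -> R) :
  nsummable a -> nsummable b ->
  (\esum_(t in [set: T]) (a t + b t)%:E = (nsum a + nsum b)%:E)%E.
Proof.
move=> sa sb; rewrite EFinD -!nsummable_esum// -esumD//.
- by move=> t _; rewrite lee_fin (proj1 sa).
- by move=> t _; rewrite lee_fin (proj1 sb).
Qed.

Lemma nsummableD (R : realType) (T : choiceType) (a b : T -> R) :
  nsummable a -> nsummable b -> nsummable (fun t => a t + b t).
Proof.
move=> sa sb; split=> [t|]; first by rewrite addr_ge0 ?(proj1 sa) ?(proj1 sb).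
by rewrite esum_EFinD// ltry.
Qed.

Lemma nsumD (R : realType) (T : choiceType) (a b : T -> R) :
  nsummable a -> nsummable b -> nsum (fun t => a t + b t) = nsum a + nsum b.
Proof. by move=> sa sb; rewrite {1}/nsum esum_EFinD. Qed.

Lemma esum_EFinZ (R : realType) (T : choiceType) (c : R) (a : T -> R) :
  0 <= c -> nsummable a ->
  (\esum_(t in [set: T]) (c * a t)%:E = (c * nsum a)%:E)%E.
Proof.
move=> c0 sa; rewrite EFinM -nsummable_esum// -esumZ// => t.
by rewrite lee_fin (proj1 sa).
Qed.

Lemma nsummableZ (R : realType) (T : choiceType) (c : R) (a : T -> R) :
  0 <= c -> nsummable a -> nsummable (fun t => c * a t).
Proof.
move=> c0 sa; split=> [t|]; first by rewrite mulr_ge0 ?(proj1 sa).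
by rewrite esum_EFinZ// ltry.
Qed.

Lemma nsumZ (R : realType) (T : choiceType) (c : R) (a : T -> R) :
  0 <= c -> nsummable a -> nsum (fun t => c * a t) = c * nsum a.
Proof. by move=> c0 sa; rewrite {1}/nsum esum_EFinZ. Qed.

(** Stated in the extended reals so that it yields finiteness as well as the value. *)
Lemma nsum_point (R : realType) (T : choiceType) (u : T) (a : T -> R) :
  0 <= a u -> (forall t, t <> u -> a t = 0) ->
  (\esum_(t in [set: T]) (a t)%:E = (a u)%:E)%E.
Proof.
move=> au0 a0; rewrite (@esumID _ _ [set u]); last first.
  move=> t _; rewrite lee_fin.
  by have [->//|/eqP tu] := eqVneq t u; rewrite a0.
rewrite setTI esum_set1 ?lee_fin// esum1 ?adde0// => t [_ /= tu].
by rewrite a0.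
Qed.

(** Tonelli: finiteness of one iterated sum passes to the other and to each of its inner sums. *)
Lemma nsum_exchange (R : realType) (T U : choiceType) (a : T -> U -> R) :
  (forall t, nsummable (a t)) -> nsummable (fun t => nsum (a t)) ->
  [/\ forall u, nsummable (a^~ u),
      nsummable (fun u => nsum (a^~ u)) &
      nsum (fun u => nsum (a^~ u)) = nsum (fun t => nsum (a t))].
Proof.
move=> sa ssa.
have a0 t u : 0 <= a t u by exact: (proj1 (sa t)).
have E : (\esum_(u in [set: U]) \esum_(t in [set: T]) (a t u)%:E =
          (nsum (fun t => nsum (a t)))%:E)%E.
  rewrite -(@esum_exchange _ _ _ (fun t u => (a t u)%:E))//.
  by rewrite -nsummable_esum//; apply: eq_esum => t _; rewrite nsummable_esum.
have s u : nsummable (a^~ u).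
  (* A single column sum is one term of a nonnegative double sum whose total is finite. *)
  split=> //; have : (\esum_(t in [set: T]) (a t u)%:E <=
     \esum_(u in [set: U]) \esum_(t in [set: T]) (a t u)%:E)%E.
    apply: le_trans (_ : (\esum_(v in [set u]) \esum_(t in [set: T])
        (a t v)%:E <= _)%E).
      by rewrite esum_set1//; apply: esum_ge0 => t _; rewrite lee_fin.
    rewrite [leRHS](@esumID _ _ [set u]) ?setTI ?leeDl//.
    - by apply: esum_ge0 => v _; apply: esum_ge0 => t _; rewrite lee_fin.
    - by move=> v _; apply: esum_ge0 => t _; rewrite lee_fin.
  by rewrite E => /le_lt_trans; apply; rewrite ltry.
have E' : (\esum_(u in [set: U]) (nsum (a^~ u))%:E =
          (nsum (fun t => nsum (a t)))%:E)%E.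
  by rewrite -E; apply: eq_esum => u _; rewrite nsummable_esum.
split=> //; last by rewrite {1}/nsum E'.
by split=> [u|]; [exact: nsum_ge0|rewrite E' ltry].
Qed.

(** * Signed real families *)

Definition rsummable (R : realType) (T : choiceType) (a : T -> R) :=
  nsummable (fun t => `|a t|).

(** Any nonnegative summable decomposition computes [rsum], not only the positive and negative parts
    used to define it. *)
Lemma rsum_sub (R : realType) (T : choiceType) (p n : T -> R) :
  nsummable p -> nsummable n ->
  rsum (fun t => p t - n t) = nsum p - nsum n.
Proof.
move=> sp sn; rewrite /rsum.
have s (b : T -> R) : nsummable b -> summable [set: T] (EFin \o b).
  move=> [b0 boo]; rewrite /summable; apply: le_lt_trans boo.
  by apply: le_esum => t _ /=; rewrite ger0_norm.
have := @esumB _ _ [set: T] (EFin \o p) (EFin \o n) (s _ sp) (s _ sn).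
move=> -> => [|t _|t _]; rewrite ?lee_fin ?(proj1 sp) ?(proj1 sn)//.
by rewrite !nsummable_esum.
Qed.

Lemma eq_rsum (R : realType) (T : choiceType) (a b : T -> R) :
  a =1 b -> rsum a = rsum b.
Proof. by move=> /funext ->. Qed.

(** Combined with [rsum_sub], this reduces facts about [rsum] to facts about [nsum]. *)
Lemma rsum_posneg (R : realType) (T : choiceType) (a : T -> R) : rsummable a ->
  exists p n, [/\ nsummable p, nsummable n, forall t, a t = p t - n t &
    forall t, `|a t| = p t + n t].
Proof.
move=> sa; exists (fun t => Num.max (a t) 0), (fun t => Num.max (- a t) 0).
split.
- by apply: nsummable_le sa => t; rewrite le_max lexx orbT/= ge_max ler_norm/=.
- apply: nsummable_le sa => t; rewrite le_max lexx orbT/= ge_max normr_ge0.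
  by rewrite -normrN ler_norm.
- by move=> t; case: (leP 0 (a t)); case: (leP 0 (- a t)); lra.
- move=> t; case: (leP 0 (a t)) => a0; last rewrite ltr0_norm//;
    first rewrite ger0_norm//; case: (leP 0 (- a t)); lra.
Qed.

Lemma norm_rsum_le (R : realType) (T : choiceType) (a : T -> R) :
  rsummable a -> `|rsum a| <= nsum (fun t => `|a t|).
Proof.
move=> /rsum_posneg[p [n [sp sn aE /funext ->]]].
rewrite (eq_rsum aE) rsum_sub// nsumD//.
have := nsum_ge0 (proj1 sp); have := nsum_ge0 (proj1 sn).
by rewrite ler_norml; lra.
Qed.

Lemma rsum_nneg (R : realType) (T : choiceType) (a : T -> R) :
  nsummable a -> rsum a = nsum a.
Proof.
move=> sa; have s0 : nsummable (fun _ : T => 0 : R).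
  by apply: nsummable_le (sa) => t; rewrite lexx (proj1 sa).
(* The subtracted 0 becomes the sum of [0 * a t], so that [rsum_sub] applies. *)
rewrite -[RHS]subr0 -(mul0r (nsum a)) -nsumZ//.
rewrite -rsum_sub//; last exact: nsummableZ.
by apply: eq_rsum => t; rewrite mul0r subr0.
Qed.

Lemma rsumD (R : realType) (T : choiceType) (a b : T -> R) :
  rsummable a -> rsummable b -> rsum (fun t => a t + b t) = rsum a + rsum b.
Proof.
move=> /rsum_posneg[p [n [sp sn /funext -> _]]].
move=> /rsum_posneg[q [m [sq sm /funext -> _]]].
rewrite (@eq_rsum _ _ _ (fun t => (p t + q t) - (n t + m t))); last first.
  by move=> t; ring.
rewrite !rsum_sub ?nsumD//; [ring|exact: nsummableD..].
Qed.

Lemma rsumZ (R : realType) (T : choiceType) (c : R) (a : T -> R) :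
  rsummable a -> rsum (fun t => c * a t) = c * rsum a.
Proof.
move=> /rsum_posneg[p [n [sp sn /funext -> _]]]; have [c0|c0] := leP 0 c.
  rewrite (@eq_rsum _ _ _ (fun t => c * p t - c * n t)); last by move=> t; ring.
  by rewrite !rsum_sub ?nsumZ//; [ring|exact: nsummableZ..].
have c0' : 0 <= - c by rewrite oppr_ge0 ltW.
(* A negative factor swaps the roles of [p] and [n], which keeps both coefficients nonnegative. *)
rewrite (@eq_rsum _ _ _ (fun t => - c * n t - - c * p t)); last by move=> t; ring.
by rewrite !rsum_sub ?nsumZ//; [ring|exact: nsummableZ..].
Qed.

Lemma rsum_point (R : realType) (T : choiceType) (u : T) (a : T -> R) :
  (forall t, t <> u -> a t = 0) -> rsum a = a u.
Proof.
move=> a0.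
rewrite (@eq_rsum _ _ _ (fun t => Num.max (a t) 0 - Num.max (- a t) 0)).
  have E (b : T -> R) : 0 <= b u -> (forall t, t <> u -> b t = 0) ->
      nsummable b /\ nsum b = b u.
    move=> bu0 b0; rewrite /nsum (nsum_point bu0 b0); split=> //; split.
      by move=> t; have [->//|/eqP tu] := eqVneq t u; rewrite b0.
    by rewrite (nsum_point bu0 b0) ltry.
  have [| |sp np] := E (fun t => Num.max (a t) 0).
  - by rewrite le_max lexx orbT.
  - by move=> t /a0 ->; rewrite maxxx.
  have [| |sn nn] := E (fun t => Num.max (- a t) 0).
  - by rewrite le_max lexx orbT.
  - by move=> t /a0 ->; rewrite oppr0 maxxx.
  rewrite rsum_sub// np nn; case: (leP 0 (a u)); case: (leP 0 (- a u)); lra.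
by move=> t; case: (leP 0 (a t)); case: (leP 0 (- a t)); lra.
Qed.

(** Fubini: the positive and negative parts are dominated by [|a t u|], and Tonelli applies to
    each. *)
Lemma rsum_exchange (R : realType) (T U : choiceType) (a : T -> U -> R) :
  (forall t, rsummable (a t)) -> nsummable (fun t => nsum (fun u => `|a t u|)) ->
  rsum (fun t => rsum (a t)) = rsum (fun u => rsum (a^~ u)).
Proof.
move=> sa ssa.
pose p t u := Num.max (a t u) 0; pose n t u := Num.max (- a t u) 0.
have pb t u : 0 <= p t u <= `|a t u|.
  by rewrite le_max lexx orbT/= ge_max ler_norm/=.
have nb t u : 0 <= n t u <= `|a t u|.
  by rewrite le_max lexx orbT/= ge_max normr_ge0 -normrN ler_norm.
have aE t u : a t u = p t u - n t u.
  by rewrite /p /n; case: (leP 0 (a t u)); case: (leP 0 (- a t u)); lra.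
have ssum (b : T -> U -> R) : (forall t u, 0 <= b t u <= `|a t u|) ->
    (forall t, nsummable (b t)) /\ nsummable (fun t => nsum (b t)).
  move=> bb; have sb t : nsummable (b t) by exact: nsummable_le (sa t).
  split=> //; apply: nsummable_le ssa => t; apply/andP; split.
    by apply: nsum_ge0 => u; exact: (proj1 (sb t)).
  exact: nsum_le (sa t).
have [sp ssp] := ssum _ pb; have [sn ssn] := ssum _ nb.
have [sp' ssp' pE] := nsum_exchange sp ssp.
have [sn' ssn' nE] := nsum_exchange sn ssn.
transitivity (nsum (fun t => nsum (p t)) - nsum (fun t => nsum (n t))).
  by rewrite -rsum_sub//; apply: eq_rsum => t; rewrite -rsum_sub//; exact: eq_rsum.
rewrite -pE -nE -rsum_sub//; apply: eq_rsum => u; rewrite -rsum_sub//.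
exact: eq_rsum.
Qed.

(** * The space l2 *)

Lemma normc_ge0 (R : rcfType) (z : R[i]) : 0 <= normc z.
Proof. by case: z => a b; exact: sqrtr_ge0. Qed.

Lemma normc_sqrE (R : rcfType) (z : R[i]) :
  normc z ^+ 2 = complex.Re z ^+ 2 + complex.Im z ^+ 2.
Proof. by case: z => a b /=; rewrite sqr_sqrtr// addr_ge0 ?sqr_ge0. Qed.

Lemma normc_conj (R : rcfType) (z : R[i]) : normc (conjc z) = normc z.
Proof. by case: z => a b /=; rewrite sqrrN. Qed.

Lemma norm_Re_le (R : rcfType) (z : R[i]) : `|complex.Re z| <= normc z.
Proof.
rewrite -ler_sqr ?nnegrE ?normc_ge0// normc_sqrE real_normK ?num_real//.
by rewrite lerDl sqr_ge0.
Qed.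

Lemma norm_Im_le (R : rcfType) (z : R[i]) : `|complex.Im z| <= normc z.
Proof.
rewrite -ler_sqr ?nnegrE ?normc_ge0// normc_sqrE real_normK ?num_real//.
by rewrite lerDr sqr_ge0.
Qed.

Lemma l2_nsummable (R : realType) (V : choiceType) (x : l2 R V) :
  nsummable (fun v => normc (x v) ^+ 2).
Proof. by split=> [v|]; [exact: sqr_ge0|have := l2P x]. Qed.

Lemma l2norm_sqr (R : realType) (V : choiceType) (x : l2 R V) :
  l2norm x ^+ 2 = nsum (fun v => normc (x v) ^+ 2).
Proof. by rewrite sqr_sqrtr//; apply: nsum_ge0 => v; exact: sqr_ge0. Qed.

Lemma l2norm_ge0 (R : realType) (V : choiceType) (x : l2 R V) : 0 <= l2norm x.
Proof. exact: sqrtr_ge0. Qed.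

(** Pointwise, |x v| |y v| is at most |x v|^2 + |y v|^2. *)
Lemma l2_mul_nsummable (R : realType) (V : choiceType) (x y : l2 R V) :
  nsummable (fun v => normc (x v * conjc (y v))).
Proof.
have := nsummableD (l2_nsummable x) (l2_nsummable y).
apply: nsummable_le => v; rewrite normc_ge0/= normcM normc_conj.
have := sqr_ge0 (normc (x v) - normc (y v)).
have := normc_ge0 (x v); have := normc_ge0 (y v); nra.
Qed.

(** * Sums of complex families and the inner product *)

Definition csum (R : realType) (T : choiceType) (z : T -> R[i]) : R[i] :=
  (rsum (fun t => complex.Re (z t)) +i* rsum (fun t => complex.Im (z t)))%C.

Definition csummable (R : realType) (T : choiceType) (z : T -> R[i]) :=
  nsummable (fun t => normc (z t)).

Lemma csummable_Re (R : realType) (T : choiceType) (z : T -> R[i]) :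
  csummable z -> rsummable (fun t => complex.Re (z t)).
Proof. by apply: nsummable_le => t; rewrite normr_ge0 norm_Re_le. Qed.

Lemma csummable_Im (R : realType) (T : choiceType) (z : T -> R[i]) :
  csummable z -> rsummable (fun t => complex.Im (z t)).
Proof. by apply: nsummable_le => t; rewrite normr_ge0 norm_Im_le. Qed.

Lemma eq_csum (R : realType) (T : choiceType) (y z : T -> R[i]) :
  y =1 z -> csum y = csum z.
Proof. by move=> /funext ->. Qed.

Lemma csum_point (R : realType) (T : choiceType) (u : T) (z : T -> R[i]) :
  (forall t, t <> u -> z t = 0) -> csum z = z u.
Proof.
move=> z0; rewrite /csum !(@rsum_point _ _ u) => [|t /z0 ->//|t /z0 ->//].
by case: (z u).
Qed.

Lemma csumZ (R : realType) (T : choiceType) (c : R[i]) (z : T -> R[i]) :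
  csummable z -> csum (fun t => c * z t) = c * csum z.
Proof.
case: c => a b sz; have sR := csummable_Re sz; have sI := csummable_Im sz.
have sZ k (f : T -> R) : rsummable f -> rsummable (fun t => k * f t).
  move=> sf; have := nsummableZ (normr_ge0 k) sf.
  by apply: nsummable_le => t; rewrite -normrM normr_ge0/=.
rewrite /csum; congr Complex.
  rewrite -mulNr -!rsumZ// -rsumD; [|exact: sZ..].
  by apply: eq_rsum => t; case: (z t) => p q /=; ring.
rewrite -!rsumZ// -rsumD; [|exact: sZ..].
by apply: eq_rsum => t; case: (z t) => p q /=; ring.
Qed.

(** Fubini for the real and imaginary parts separately, each dominated by the modulus. *)
Lemma csum_exchange (R : realType) (T U : choiceType) (z : T -> U -> R[i]) :
  (forall t, csummable (z t)) ->
  nsummable (fun t => nsum (fun u => normc (z t u))) ->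
  csum (fun t => csum (z t)) = csum (fun u => csum (z^~ u)).
Proof.
move=> sz ssz; rewrite /csum; congr Complex; apply: rsum_exchange.
- by move=> t; exact: csummable_Re.
- apply: nsummable_le ssz => t; apply/andP; split.
    exact: nsum_ge0.
  by apply: nsum_le (sz t) => u; rewrite normr_ge0 norm_Re_le.
- by move=> t; exact: csummable_Im.
- apply: nsummable_le ssz => t; apply/andP; split.
    exact: nsum_ge0.
  by apply: nsum_le (sz t) => u; rewrite normr_ge0 norm_Im_le.
Qed.

(** [csum] has the shape of the body of [dot], so this holds by conversion and carries the facts on
    [csum] over to inner products. *)
Lemma dot_csum (R : realType) (V : choiceType) (x y : l2 R V) :
  dot x y = csum (fun v => x v * conjc (y v)).
Proof. by []. Qed.

Lemma eE (R : realType) (V : choiceType) (u v : V) :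
  (e u : l2 R V) v = (v == u)%:R.
Proof. by []. Qed.

(** Reads a coordinate off an inner product; this later determines the adjoint. *)
Lemma dot_e (R : realType) (V : choiceType) (u : V) (y : l2 R V) :
  dot (e u) y = conjc (y u).
Proof.
rewrite dot_csum (@csum_point _ _ u) => [|t tu].
  by rewrite eE eqxx mul1r.
by rewrite eE (introF eqP tu) mul0r.
Qed.

Lemma csum_real (R : realType) (T : choiceType) (a : T -> R) :
  nsummable a -> csum (fun t => ((a t)%:C)%C) = ((nsum a)%:C)%C.
Proof.
move=> sa; apply/eqP; rewrite eq_complex /= rsum_nneg// eqxx/=; apply/eqP.
transitivity (rsum (fun t => 0 * a t)).
  by apply: eq_rsum => t; rewrite mul0r.
by rewrite rsum_nneg ?nsumZ ?mul0r//; exact: nsummableZ.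
Qed.

(* The non-sharp constant 2 comes from bounding the real and imaginary parts
   separately. *)
Lemma normc_csum_le (R : realType) (T : choiceType) (z : T -> R[i]) :
  csummable z -> normc (csum z) ^+ 2 <= 2 * nsum (fun t => normc (z t)) ^+ 2.
Proof.
move=> sz; rewrite normc_sqrE/=.
have n0 : 0 <= nsum (fun t => normc (z t)) by apply: nsum_ge0 => t; exact: normc_ge0.
have HR : `|rsum (fun t => complex.Re (z t))| <= nsum (fun t => normc (z t)).
  apply: le_trans (norm_rsum_le (csummable_Re sz)) _; apply: nsum_le (sz) => t.
  by rewrite normr_ge0 norm_Re_le.
have HI : `|rsum (fun t => complex.Im (z t))| <= nsum (fun t => normc (z t)).
  apply: le_trans (norm_rsum_le (csummable_Im sz)) _; apply: nsum_le (sz) => t.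
  by rewrite normr_ge0 norm_Im_le.
rewrite -(real_normK (num_real (rsum (fun t => complex.Re (z t))))).
rewrite -(real_normK (num_real (rsum (fun t => complex.Im (z t))))).
have := ler_pM (normr_ge0 _) (normr_ge0 _) HR HR.
have := ler_pM (normr_ge0 _) (normr_ge0 _) HI HI.
rewrite -!expr2; lra.
Qed.

(** * Weighted shifts *)

(** Total maps [p] and [w] replace [par] and [lambda], which live only on non-roots. Taking a bare
    function [T] lets the predicate apply to [iter 3 T] as well. *)
Definition weighted_composition (R : realType) (V : choiceType) (p : V -> V)
    (w : V -> R[i]) (T : l2 R V -> l2 R V) :=
  forall x v, T x v = w v * x (p v).

Lemma weighted_shift_composition (R : realType) (V : choiceType)
    (G : parent_graph V) (lambda : V0 G -> R[i]) (S : bounded_operator R V) :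
  is_weighted_shift lambda S -> exists p w, weighted_composition p w S.
Proof.
move=> hS.
have pw v : exists uc : V * R[i], forall x, S x v = uc.2 * x uc.1.
  have [vV0|/contrapT vr] := pselect (V0 G v).
    pose v' : V0 G := SigSub (mem_set vV0).
    by exists (par v', lambda v') => x; rewrite -(proj1 (hS x)).
  (* At a root the weight is 0, so any vertex can stand in for the missing parent. *)
  by exists (v, 0) => x; rewrite (proj2 (hS x))// mul0r.
have /choice[uc ucE] := pw.
by exists (fun v => (uc v).1), (fun v => (uc v).2).
Qed.

Lemma weighted_composition_iter3 (R : realType) (V : choiceType) (p : V -> V)
    (w : V -> R[i]) (T : l2 R V -> l2 R V) : weighted_composition p w T ->
  weighted_composition (fun v => p (p (p v)))
    (fun v => w v * w (p v) * w (p (p v))) (iter 3 T).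
Proof. by move=> hT x v; rewrite /= !hT !mulrA. Qed.

(* The vectors T (e u) have pairwise disjoint supports. *)
Lemma weighted_composition_norm (R : realType) (V : choiceType) (p : V -> V)
    (w : V -> R[i]) (T : l2 R V -> l2 R V) (x : l2 R V) :
  weighted_composition p w T ->
  nsummable (fun u => l2norm (T (e u)) ^+ 2 * normc (x u) ^+ 2) /\
  l2norm (T x) ^+ 2 = nsum (fun u => l2norm (T (e u)) ^+ 2 * normc (x u) ^+ 2).
Proof.
move=> hT.
(* Row [v] of this table has its only possibly nonzero entry at [u = p v] and sums to |T x v|^2;
   column [u] sums to ||T (e u)||^2 |x u|^2. Tonelli equates the totals. *)
pose a v u := normc (x u) ^+ 2 * normc (T (e u) v) ^+ 2.
have a0 v u : 0 <= a v u by rewrite mulr_ge0 ?sqr_ge0.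
have ap v u : u <> p v -> a v u = 0.
  move=> upv; rewrite /a hT eE (introF eqP) ?mulr0 ?normc0 ?expr0n ?mulr0//.
  by move=> puv; apply: upv.
have aE v : (\esum_(u in [set: V]) (a v u)%:E = (normc (T x v) ^+ 2)%:E)%E.
  rewrite (@nsum_point _ _ (p v))//; last exact: ap.
  by rewrite /a !hT eE eqxx mulr1 normcM exprMn mulrC.
have sa v : nsummable (a v) by split=> //; rewrite aE ltry.
have naE v : nsum (a v) = normc (T x v) ^+ 2 by rewrite /nsum aE.
have ssa : nsummable (fun v => nsum (a v)).
  by rewrite (funext naE); exact: l2_nsummable.
have naE' u : nsum (a^~ u) = l2norm (T (e u)) ^+ 2 * normc (x u) ^+ 2.
  by rewrite nsumZ ?sqr_ge0 -?l2norm_sqr 1?mulrC//; exact: l2_nsummable.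
have [_] := nsum_exchange sa ssa.
by rewrite (funext naE) (funext naE') l2norm_sqr.
Qed.

(** Fubini on the table [z v u]: row [v] is supported at [u = p v], so its absolute summability is
    that of the products [T x v * conjc (y v)]. *)
Lemma weighted_composition_dot (R : realType) (V : choiceType) (p : V -> V)
    (w : V -> R[i]) (T : l2 R V -> l2 R V) (x y : l2 R V) :
  weighted_composition p w T ->
  dot (T x) y = csum (fun u => x u * dot (T (e u)) y).
Proof.
move=> hT.
pose z v u := x u * (T (e u) v * conjc (y v)).
have zp v u : u <> p v -> z v u = 0.
  move=> upv; rewrite /z hT eE (introF eqP) ?mulr0 ?mul0r ?mulr0//.
  by move=> puv; apply: upv.
have zE v : z v (p v) = T x v * conjc (y v).
  by rewrite /z !hT eE eqxx mulr1 mulrA (mulrC (x _)).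
have nzE v : (\esum_(u in [set: V]) (normc (z v u))%:E =
    (normc (T x v * conjc (y v)))%:E)%E.
  rewrite (@nsum_point _ _ (p v)) ?zE// ?normc_ge0// => u /zp ->.
  by rewrite normc0.
have sz v : csummable (z v).
  by split=> [u|]; [exact: normc_ge0|rewrite nzE ltry].
have ssz : nsummable (fun v => nsum (fun u => normc (z v u))).
  rewrite (_ : (fun v => _) = (fun v => normc (T x v * conjc (y v)))).
    exact: l2_mul_nsummable.
  by apply/funext => v; rewrite /nsum nzE.
transitivity (csum (fun v => csum (z v))).
  by apply: eq_csum => v; rewrite (@csum_point _ _ (p v)) ?zE//; exact: zp.
rewrite csum_exchange//; apply: eq_csum => u.
by rewrite csumZ//; exact: l2_mul_nsummable.
Qed.

Lemma l2norm_e (R : realType) (V : choiceType) (u : V) : l2norm (e u : l2 R V) = 1.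
Proof.
apply/eqP; rewrite -sqrp_eq1 ?l2norm_ge0// l2norm_sqr /nsum (@nsum_point _ _ u).
- by rewrite eE eqxx normc1 expr1n.
- exact: sqr_ge0.
- by move=> t tu; rewrite eE (introF eqP tu) normc0 expr0n.
Qed.

(* By Cauchy-Schwarz on the support of T (e u),
   |<T (e u), y>|^2 <= 2 * ||T (e u)||^2 * sum_(p v = u) |y v|^2,
   and these supports partition V. *)
Lemma weighted_composition_dot_l2 (R : realType) (V : choiceType) (p : V -> V)
    (w : V -> R[i]) (T : bounded_operator R V) (y : l2 R V) :
  weighted_composition p w T ->
  (fun u => conjc (dot (T (e u)) y) : R[i]^o) \in @square_summable R V.
Proof.
move=> hT.
(* Distributes the mass of [y] over the fibres of [p]: row [v] sums to |y v|^2, column [u] to the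
   mass of [y] on the fibre above [u]. *)
pose b v u : R := (p v == u)%:R * normc (y v) ^+ 2.
have b0 v u : 0 <= b v u by rewrite mulr_ge0 ?sqr_ge0.
have bE v : (\esum_(u in [set: V]) (b v u)%:E = (normc (y v) ^+ 2)%:E)%E.
  rewrite (@nsum_point _ _ (p v))//; first by rewrite /b eqxx mul1r.
  by move=> u upv; rewrite /b (introF eqP) ?mul0r// => /esym.
have sb v : nsummable (b v) by split=> //; rewrite bE ltry.
have nbE v : nsum (b v) = normc (y v) ^+ 2 by rewrite /nsum bE.
have ssb : nsummable (fun v => nsum (b v)).
  by rewrite (funext nbE); exact: l2_nsummable.
have [sb' ssb' _] := nsum_exchange sb ssb.
have [M hM] := op_bounded T.
(* Boundedness enters here, as a bound on all [T (e u)] uniform in [u]. *)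
have T1 u : l2norm (T (e u)) <= `|M|.
  by apply: le_trans (hM _) _; rewrite l2norm_e mulr1 ler_norm.
have bound u : normc (dot (T (e u)) y) ^+ 2 <= (2 * `|M| ^+ 2) * nsum (b^~ u).
  have sz := l2_mul_nsummable (T (e u)) y.
  apply: le_trans (normc_csum_le sz) _; rewrite -mulrA ler_pM2l//.
  apply: (@le_trans _ _ (nsum (b^~ u) * l2norm (T (e u)) ^+ 2)); last first.
    rewrite mulrC ler_wpM2r ?nsum_ge0//.
    by rewrite ler_sqr ?nnegrE ?l2norm_ge0.
  (* Cauchy-Schwarz via the discriminant: on the fibre, 2 k |w v| |y v| <= |y v|^2 + k^2 |w v|^2
     termwise, and off it the products vanish. *)
  apply: sq_le_mul_of_quadratic; rewrite ?sqr_ge0 ?nsum_ge0//.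
    by move=> v; exact: normc_ge0.
  move=> k k0; have k2 : 0 <= 2 * k by lra.
  rewrite l2norm_sqr -!nsumZ ?sqr_ge0//; last exact: l2_nsummable.
  rewrite -nsumD//; last by apply: nsummableZ (l2_nsummable _); exact: sqr_ge0.
  apply: nsum_le; last first.
    by apply: nsummableD => //; apply: nsummableZ (l2_nsummable _); exact: sqr_ge0.
  move=> v; rewrite !mulr_ge0 ?normc_ge0//=; last lra.
  rewrite /b hT eE; case: eqP => _.
    rewrite mulr1 mul1r normcM normc_conj.
    by have := sqr_ge0 (k * normc (w v) - normc (y v)); lra.
  by rewrite mulr0 !mul0r normc0 expr0n/= !mulr0 addr0.
have M0 : 0 <= 2 * `|M| ^+ 2 by rewrite mulr_ge0 ?sqr_ge0.
have : nsummable (fun u => normc (conjc (dot (T (e u)) y)) ^+ 2).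
  by apply: nsummable_le (nsummableZ M0 ssb') => u; rewrite normc_conj sqr_ge0 bound.
by case.
Qed.

(** * The adjoint and the diagonal operator [S^* S] *)

(** These coordinates define a square summable vector that satisfies the adjoint identity, so [xget]
    returns a genuine adjoint; testing that adjoint against [e u] forces its coordinates. *)
Lemma weighted_composition_adjoint (R : realType) (V : choiceType) (p : V -> V)
    (w : V -> R[i]) (T : bounded_operator R V) (y : l2 R V) (u : V) :
  weighted_composition p w T -> adjoint T y u = conjc (dot (T (e u)) y).
Proof.
move=> hT; have : is_adjoint T (adjoint T).
  rewrite /adjoint; apply: xgetPex.
  exists (fun y => L2 (weighted_composition_dot_l2 y hT)) => x z.
  rewrite (weighted_composition_dot _ _ hT) dot_csum; apply: eq_csum => v.
  by congr (_ * _); rewrite -[LHS]conjcK.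
by move=> /(_ (e u) y) ->; rewrite dot_e conjcK.
Qed.

(** On the fibre [p v = u], which contains the support of [T (e u)], the vector [T x] equals [x u]
    times [T (e u)]. *)
Lemma weighted_composition_adjointK (R : realType) (V : choiceType) (p : V -> V)
    (w : V -> R[i]) (T : bounded_operator R V) (x : l2 R V) (u : V) :
  weighted_composition p w T ->
  adjoint T (T x) u = x u * ((l2norm (T (e u)) ^+ 2)%:C)%C.
Proof.
move=> hT; rewrite (weighted_composition_adjoint _ _ hT).
have sr := l2_nsummable (T (e u)).
(* The right side is also written as a conjugate, its real factor being fixed by conjugation. *)
rewrite dot_csum l2norm_sqr -[x u in RHS]conjcK -[X in _ * X]conjc_real -rmorphM.
congr conjc; rewrite -csum_real// -csumZ.
  apply: eq_csum => v; rewrite !hT eE; case: eqP => [<-|_].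
    rewrite !mulr1 rmorphM mulrA mulrC; congr (_ * _).
    case: (w v) => a b; apply/eqP.
    rewrite eq_complex/= sqr_sqrtr ?addr_ge0 ?sqr_ge0//.
    by apply/andP; split; apply/eqP; ring.
  by rewrite mulr0 mul0r normc0 expr0n/= mulr0.
apply: nsummable_le sr => v; rewrite normc_ge0/=.
by rewrite expr0n/= addr0 sqrtr_sqr ger0_norm ?sqr_ge0.
Qed.

Lemma normc_real (R : rcfType) (a : R) : 0 <= a -> normc (a%:C)%C = a.
Proof. by move=> a0; rewrite /= expr0n/= addr0 sqrtr_sqr ger0_norm. Qed.

Lemma weighted_composition_adjointK_norm (R : realType) (V : choiceType)
    (p : V -> V) (w : V -> R[i]) (T : bounded_operator R V) (x : l2 R V) :
  weighted_composition p w T ->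
  nsummable (fun u => l2norm (T (e u)) ^+ 4 * normc (x u) ^+ 2) /\
  l2norm (adjoint T (T x)) ^+ 2 =
  nsum (fun u => l2norm (T (e u)) ^+ 4 * normc (x u) ^+ 2).
Proof.
move=> hT; rewrite (_ : (fun u => _) = fun u => normc (adjoint T (T x) u) ^+ 2).
  by rewrite l2norm_sqr; split=> //; exact: l2_nsummable.
apply/funext => u.
rewrite (weighted_composition_adjointK _ _ hT) normcM exprMn mulrC.
by rewrite normc_real ?sqr_ge0// -exprM.
Qed.

(** * Equivalence with the quadratic inequalities on basis vectors *)

Theorem theorem3p2 (R : realType) (V : choiceType) (G : parent_graph V)
    (lambda : V0 G -> R[i]) (S : bounded_operator R V)
    (hS : is_weighted_shift lambda S) :
  quasi_star_paranormal S <->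
  (forall (k : R) (v : V), 0 < k ->
     0 <= l2norm (iter 3 S (e v)) ^+ 2 - 2 * k * l2norm (S (e v)) ^+ 4
          + k ^+ 2 * l2norm (S (e v)) ^+ 2).
Proof.
have [p [w hT]] := weighted_shift_composition hS.
have hT3 := weighted_composition_iter3 hT.
split=> [h k v k0|h x].
  (* On [e v] the diagonal form turns the hypothesis into ||S e_v||^4 <= ||S^3 e_v|| ||S e_v||. *)
  have := h (e v); have [_ ->] := weighted_composition_adjointK_norm (e v) hT.
  rewrite /nsum (@nsum_point _ _ v); first last.
  - by move=> t tv; rewrite eE (introF eqP tv) normc0 expr0n mulr0.
  - by rewrite mulr_ge0 ?exprn_ge0 ?l2norm_ge0 ?normc_ge0.
  rewrite eE eqxx normc1 expr1n mulr1 [fine _]/= => le4.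
  have := ler_wpM2l (ltW k0) le4.
  (* With a = ||S^3 e_v|| and b = ||S e_v||, the square (a - k b)^2 gives 2 k a b <= a^2 + k^2
     b^2. *)
  by have := sqr_ge0 (l2norm (iter 3 S (e v)) - k * l2norm (S (e v))); lra.
(* Squaring leaves only squared norms, which are sums linear in the weights |x u|^2. *)
rewrite -ler_sqr ?nnegrE; [|exact: sqr_ge0|by apply: mulr_ge0; exact: l2norm_ge0].
rewrite [leRHS]exprMn.
apply: sq_le_mul_of_quadratic; rewrite ?sqr_ge0// => k k0.
have [s1 ->] := weighted_composition_norm x hT.
have [s3 ->] := weighted_composition_norm x hT3.
have [s4 ->] := weighted_composition_adjointK_norm x hT.
have k2 := sqr_ge0 k; have kk : 0 <= 2 * k by lra.
rewrite -!nsumZ// -nsumD//; last exact: nsummableZ.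
apply: nsum_le => [u|]; last by apply: nsummableD => //; exact: nsummableZ.
apply/andP; split.
  by rewrite mulr_ge0//; exact: (proj1 s4).
(* The termwise inequality is the hypothesis at [e u] multiplied by |x u|^2. *)
rewrite -subr_ge0; apply: le_trans (mulr_ge0 (h k u k0) (sqr_ge0 (normc (x u)))) _.
by rewrite le_eqVlt; apply/orP; left; apply/eqP; ring.
Qed.
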